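(* Let $n,m\ge 1$, let $1\le p\le\infty$ and let $q=p/(p-1)$ be the conjugate exponent (with $q=\infty$ if $p=1$ and $q=1$ if $p=\infty$). Let $\mathcal L_1,\dots,\mathcal L_m:\mathbb{R}^n\to\mathbb{R}$ be differentiable, let $\theta\in\mathbb{R}^n$, and suppose $g_i:=\nabla\mathcal L_i(\theta)\ne 0$ for all $i$. Set $\hat g_i^{(p)}:=g_i/\|g_i\|_p$, and let $(v^\star,r^\star)$ be an optimal solution of $$\max_{v\in\mathbb{R}^n,\;r\in\mathbb{R}}\ r\quad\text{s.t.}\quad (\hat g_i^{(p)})^\top v\ge r,\ i=1,\dots,m,\quad \|v\|_q\le 1 .$$ If $r^\star=0$, then $\theta$ is Pareto-stationary for the multi-objective problem $\min_{\theta\in\mathbb{R}^n}(\mathcal L_1(\theta),\dots,\mathcal L_m(\theta))$.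
   Context: $\|\cdot\|_p$ and $\|\cdot\|_q$ denote the $\ell_p$ and $\ell_q$ norms on $\mathbb{R}^n$. A point $\theta\in\mathbb{R}^n$ is Pareto-stationary if there exists $\alpha\in\mathbb{R}^m$ with $\alpha_i\ge 0$ for all $i$, $\sum_{i=1}^m\alpha_i=1$ and $\sum_{i=1}^m\alpha_i\nabla\mathcal L_i(\theta)=0$. *)

(* Defs.v *)
From mathcomp Require Import all_boot all_order all_algebra.
From mathcomp Require Import all_classical all_reals all_analysis.
Set Implicit Arguments.
Unset Strict Implicit.
Unset Printing Implicit Defensive.
Import Order.TTheory GRing.Theory Num.Theory.
Import numFieldNormedType.Exports.

Local Open Scope ring_scope.

Definition dotv (R : realType) (n : nat) (u v : 'rV[R]_n) : R :=
  \sum_(j < n) u 0 j * v 0 j.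

(* Only exponents [1 <= p <= +oo] are meaningful; [-oo] is a junk case. *)
Definition lp_norm (R : realType) (n : nat) (p : \bar R) (x : 'rV[R]_n) : R :=
  match p with
  | EFin s => (\sum_(j < n) `|x 0 j| `^ s) `^ s^-1
  | +oo%E => \big[Num.max/0]_(j < n) `|x 0 j|
  | -oo%E => 0
  end.

(* For differentiable [f], [dotv (gradient f x) v = 'd f x v]. *)
Definition gradient (R : realType) (n : nat) (f : 'rV[R]_n -> R)
    (x : 'rV[R]_n) : 'rV[R]_n :=
  \row_(j < n) 'D_(delta_mx 0 j) f x.

Definition normalized (R : realType) (n : nat) (p : \bar R) (g : 'rV[R]_n) :
    'rV[R]_n :=
  (lp_norm p g)^-1 *: g.

Definition feasible (R : realType) (n m : nat) (q : \bar R)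
    (g : 'I_m -> 'rV[R]_n) (v : 'rV[R]_n) (r : R) : Prop :=
  (forall i, r <= dotv (g i) v) /\ lp_norm q v <= 1.

Definition optimal_solution (R : realType) (n m : nat) (q : \bar R)
    (g : 'I_m -> 'rV[R]_n) (v : 'rV[R]_n) (r : R) : Prop :=
  feasible q g v r /\
  forall (v' : 'rV[R]_n) (r' : R), feasible q g v' r' -> r' <= r.

Definition Pareto_stationary (R : realType) (n m : nat)
    (L : 'I_m -> 'rV[R]_n -> R) (theta : 'rV[R]_n) : Prop :=
  exists alpha : 'I_m -> R,
    [/\ forall i, 0 <= alpha i,
        \sum_(i < m) alpha i = 1
      & \sum_(i < m) alpha i *: gradient (L i) theta = 0].

(* Main.v *)
(* If no vector has positive inner product with every gradient, then Gordan's
   alternative gives a convex combination of the normalized gradients that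
   vanishes, and dividing its weights by the norms and renormalizing gives the
   Pareto weights. If such a vector existed, a small positive multiple of it would
   be feasible with a positive value of r, contradicting r* = 0. *)
Require Import Defs.
From mathcomp Require Import all_boot all_order all_algebra.
From mathcomp Require Import all_classical all_reals all_analysis.
From mathcomp Require Import ring lra.
Set Implicit Arguments.
Unset Strict Implicit.
Unset Printing Implicit Defensive.
Import Order.TTheory GRing.Theory Num.Theory.
Import numFieldNormedType.Exports.

Local Open Scope ring_scope.

Lemma dotvC (R : realType) (n : nat) (u v : 'rV[R]_n) : dotv u v = dotv v u.
Proof. by apply: eq_bigr => j _; rewrite mulrC. Qed.

Lemma dotvDr (R : realType) (n : nat) (u v w : 'rV[R]_n) :
  dotv u (v + w) = dotv u v + dotv u w.
Proof. by rewrite -big_split; apply: eq_bigr => j _; rewrite mxE mulrDr. Qed.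

Lemma dotvZr (R : realType) (n : nat) (c : R) (u v : 'rV[R]_n) :
  dotv u (c *: v) = c * dotv u v.
Proof. by rewrite mulr_sumr; apply: eq_bigr => j _; rewrite mxE mulrCA. Qed.

(** Viewing the squared Euclidean norm as a quadratic in [t] allows the minimality test in [Gordan]
    to be reduced to scalar arithmetic. *)
Lemma dotv_segment (R : realType) (n : nat) (t : R) (u v : 'rV[R]_n) :
  dotv (u + t *: v) (u + t *: v) =
  dotv u u + 2 * t * dotv u v + t ^+ 2 * dotv v v.
Proof.
rewrite dotvDr dotvZr [dotv _ u]dotvC [dotv _ v]dotvC !dotvDr !dotvZr.
by rewrite (dotvC v u); ring.
Qed.

Lemma dotv_ge0 (R : realType) (n : nat) (u : 'rV[R]_n) : 0 <= dotv u u.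
Proof. by apply: sumr_ge0 => j _; rewrite -expr2 sqr_ge0. Qed.

Lemma dotv_gt0 (R : realType) (n : nat) (u : 'rV[R]_n) :
  u != 0 -> 0 < dotv u u.
Proof.
move=> u0; rewrite lt_def dotv_ge0 andbT; apply: contra u0 => /eqP uu0.
apply/eqP/rowP => j; rewrite mxE; apply/eqP.
rewrite -sqrf_eq0 expr2; apply/eqP.
by apply: (psumr_eq0P _ uu0) => // k _; rewrite -expr2 sqr_ge0.
Qed.

Lemma lp_norm_ge0 (R : realType) (n : nat) (p : \bar R) (x : 'rV[R]_n) :
  0 <= lp_norm p x.
Proof.
case: p => [s| |] //=; first exact: powR_ge0.
exact: bigmax_ge_id.
Qed.

Lemma lp_normZ (R : realType) (n : nat) (p : \bar R) (c : R) (x : 'rV[R]_n) :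
  (1%:E <= p)%E -> lp_norm p (c *: x) = `|c| * lp_norm p x.
Proof.
case: p => [s| |] //=.
- rewrite lee_fin => s1; have s0 : s != 0 by rewrite gt_eqF// (lt_le_trans ltr01).
  under eq_bigr do rewrite mxE normrM powRM//.
  rewrite -mulr_sumr powRM ?powR_ge0//; last first.
    by apply: sumr_ge0 => j _; exact: powR_ge0.
  by rewrite -powRrM divff// powRr1.
(* Multiplying by [|c| >= 0] commutes with [Num.max] and fixes the default value 0, so it passes
   through the big maximum. *)
- move=> _; rewrite (big_morph _ (fun a b => maxr_pMr a b (normr_ge0 c)) (mulr0 _)).
  by apply: eq_bigr => j _; rewrite mxE normrM.
Qed.

Lemma lp_norm_gt0 (R : realType) (n : nat) (p : \bar R) (x : 'rV[R]_n) :
  (1%:E <= p)%E -> x != 0 -> 0 < lp_norm p x.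
Proof.
move=> p1 x0; have [j xj] : exists j, x 0 j != 0.
  apply/existsP; apply: contraNT x0; rewrite negb_exists => /forallP x0.
  by apply/eqP/rowP => j; rewrite mxE; apply/eqP; rewrite -[_ == _]negbK.
case: p p1 => [s| |] //=.
- move=> _; apply: powR_gt0; rewrite (bigD1 j)//= ltr_pwDl ?powR_gt0 ?normr_gt0//.
  by apply: sumr_ge0 => k _; exact: powR_ge0.
- move=> _; rewrite (@lt_le_trans _ _ `|x 0 j|) ?normr_gt0//.
  exact: (le_bigmax 0 (fun k => `|x 0 k|)).
Qed.

(* The upper bound [a 0 i <= 1] is redundant; it exhibits the simplex as a closed
   subset of a box. *)
Definition simplex (R : realType) (m : nat) : set 'rV[R]_m :=
  [set a | (forall i, a 0 i \in `[0, 1]%R) /\ \sum_(i < m) a 0 i = 1]%classic.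

Lemma simplex_compact (R : realType) (m : nat) : compact (@simplex R m).
Proof.
have sum_cont : continuous (fun a : 'rV[R]_m => \sum_(i < m) a 0 i).
  apply: continuous_big => [|i _]; first exact: add_continuous.
  exact: coord_continuous.
have box := @rV_compact R m (fun=> `[0, 1]%classic) (fun=> @segment_compact R 0 1).
have hyperplane := preimage_closed (in1W sum_cont) (@closed_eq R 1).
exact: compact_closedI box hyperplane.
Qed.

Definition lincomb (R : realType) (n m : nat) (g : 'I_m -> 'rV[R]_n)
  (a : 'rV[R]_m) : 'rV[R]_n := \sum_(i < m) a 0 i *: g i.

Lemma dotv_lincomb_continuous (R : realType) (n m : nat)
    (g : 'I_m -> 'rV[R]_n) :
  continuous (fun a : 'rV[R]_m => dotv (lincomb g a) (lincomb g a)).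
Proof.
have coord_cont j : continuous (fun a : 'rV[R]_m => lincomb g a 0 j).
  have -> : (fun a : 'rV[R]_m => lincomb g a 0 j) =
            (fun a => \sum_(i < m) a 0 i * g i 0 j).
    by apply/funext => a; rewrite summxE; apply: eq_bigr => i _; rewrite mxE.
  apply: continuous_big => [|i _]; first exact: add_continuous.
  move=> a; apply: continuousM; last exact: cst_continuous.
  exact: coord_continuous.
apply: continuous_big => [|j _]; first exact: add_continuous.
by move=> a; apply: continuousM; exact: coord_cont.
Qed.

(** A step from [a] towards a vertex is a convex combination; such points are the competitors of the
    minimizer in [Gordan]. *)
Lemma simplex_segment (R : realType) (m : nat) (a : 'rV[R]_m) (i : 'I_m) (t : R) :
  simplex a -> 0 <= t <= 1 -> simplex (a + t *: (delta_mx 0 i - a)).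
Proof.
move=> [a01 a1] t01; split => [k|].
  have := a01 k; rewrite !in_itv /= !mxE eqxx /= => /andP[ak0 ak1].
  by case: (k == i) => /=; apply/andP; split; nra.
under eq_bigr do rewrite !mxE eqxx /=.
rewrite big_split /= a1 -mulr_sumr sumrB a1 (bigD1 i)//= eqxx big1.
  by rewrite addr0 subrr mulr0 addr0.
by move=> k /negbTE->.
Qed.

Lemma lincomb_segment (R : realType) (n m : nat) (g : 'I_m -> 'rV[R]_n)
    (a : 'rV[R]_m) (i : 'I_m) (t : R) :
  lincomb g (a + t *: (delta_mx 0 i - a)) =
  lincomb g a + t *: (g i - lincomb g a).
Proof.
rewrite /lincomb; under eq_bigr do rewrite !mxE eqxx /= scalerDl -scalerA scalerBl.
rewrite big_split /= -scaler_sumr sumrB; congr (_ + _ *: (_ - _)).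
rewrite (bigD1 i)//= eqxx scale1r big1 ?addr0// => k /negbTE->.
by rewrite scale0r.
Qed.

(* The alternative is decided by the point of least Euclidean norm of the convex
   hull of the [g i]: it is either zero or the normal of a strictly separating
   hyperplane through the origin. *)
Lemma Gordan (R : realType) (n m : nat) (g : 'I_m -> 'rV[R]_n) :
  (exists v, forall i, 0 < dotv (g i) v) \/
  (exists a : 'I_m -> R, [/\ forall i, 0 <= a i, \sum_(i < m) a i = 1
                          & \sum_(i < m) a i *: g i = 0]).
Proof.
(* For [m = 0] the first alternative holds vacuously; otherwise the simplex has a vertex. *)
case: m g => [|m] g; first by left; exists 0 => -[].
have simplex0 : (@simplex R m.+1 !=set0)%classic.
  exists (delta_mx 0 0); split => [k|].
    by rewrite in_itv /= mxE eqxx; case: (k == 0); rewrite /= lexx ler01.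
  rewrite (bigD1 0)//= mxE !eqxx big1 ?addr0// => k /negbTE k0.
  by rewrite mxE k0.
have [a] := compact_EVT_min simplex0 (@simplex_compact R m.+1)
  (continuous_subspaceT (@dotv_lincomb_continuous R n m.+1 g)).
rewrite inE => sa amin; set x := lincomb g a in amin.
have [x0|x_neq0] := eqVneq x 0.
  right; exists (a 0); split => //; last by case: sa.
  by move=> i; have := sa.1 i; rewrite in_itv /= => /andP[].
left; exists x => i.
(* Since [g i = x + (g i - x)], this bound yields [dotv (g i) x >= dotv x x > 0]. *)
suff: 0 <= dotv x (g i - x).
  by move=> h; rewrite dotvC -[g i](subrKC x) dotvDr ltr_wpDr// dotv_gt0.
rewrite leNgt; apply/negP => s_lt0; set d := g i - x in s_lt0.
have := dotv_ge0 d; set N := dotv d d; set s := dotv x d in s_lt0 * => N0.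
have Ns0 : 0 < N - s by lra.
(* The denominator [N - s], rather than the [N] of the exact minimizer, keeps [t] in (0, 1] using
   only [N >= 0] and [s < 0]. The squared norm then changes by [2 * t * s + t ^+ 2 * N = t * s * (1
   + t) < 0], against minimality. *)
pose t := - s / (N - s).
have t_gt0 : 0 < t by rewrite divr_gt0// oppr_gt0.
have tNs : t * (N - s) = - s by rewrite divfK// gt_eqF.
have t_le1 : t <= 1 by rewrite ler_pdivrMr//; lra.
have t01 : 0 <= t <= 1 by rewrite t_le1 ltW.
have := amin _ (mem_set (simplex_segment i sa t01)).
rewrite lincomb_segment -/x -/d dotv_segment -/s -/N.
nra.
Qed.

Theorem proposition3p6 (R : realType) (n m : nat) (hn : (1 <= n)%N)
    (hm : (1 <= m)%N) (p : \bar R) (hp : (1%:E <= p)%E)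
    (L : 'I_m -> 'rV[R]_n -> R)
    (hL : forall (i : 'I_m) (x : 'rV[R]_n), differentiable (L i) x)
    (theta : 'rV[R]_n)
    (hg : forall i : 'I_m, gradient (L i) theta <> 0)
    (vstar : 'rV[R]_n) (rstar : R)
    (hopt : optimal_solution (hoelder_conjugate p)
              (fun i : 'I_m => normalized p (gradient (L i) theta))
              vstar rstar) :
  rstar = 0 -> Pareto_stationary L theta.
Proof.
move=> rstar0; set q := hoelder_conjugate p in hopt.
have q1 : (1%:E <= q)%E by exact: hoelder_conj_ge1.
pose G i := gradient (L i) theta.
have Gp_gt0 i : 0 < lp_norm p (G i) by apply: lp_norm_gt0 => //; exact/eqP/hg.
have [[v v_gt0]|[a [a0 a1 aG]]] := Gordan (fun i => normalized p (G i)).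
(* Adding 1 makes the denominator positive and larger than [lp_norm q v], so [c *: v] lies in the
   unit ball. *)
- pose c := (1 + lp_norm q v)^-1.
  have c_gt0 : 0 < c by rewrite invr_gt0 ltr_pwDl// lp_norm_ge0.
  (* The default value 1 is positive, so [r] is positive as soon as every inner product is. *)
  pose r := \big[Num.min/1]_(i < m) dotv (normalized p (G i)) (c *: v).
  have r_gt0 : 0 < r by apply: lt_bigmin => // i _; rewrite dotvZr mulr_gt0// v_gt0.
  suff /(hopt.2 _) : feasible q (fun i => normalized p (G i)) (c *: v) r.
    by rewrite rstar0 leNgt r_gt0.
  split=> [i|]; first exact: bigmin_le.
  rewrite lp_normZ// gtr0_norm// mulrC ler_pdivrMr ?mul1r ?lerDr ?ler01//.
  by rewrite -invr_gt0.
- pose w i := a i / lp_norm p (G i).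
  have w0 i : 0 <= w i by rewrite divr_ge0// ltW.
  pose S := \sum_(i < m) w i.
  have S_gt0 : 0 < S.
    (* If [S] vanished, so would each nonnegative [w i], hence each [a i], although the [a i] sum to
       1. *)
    rewrite lt_def sumr_ge0 ?andbT//; apply/eqP => S0.
    suff : \sum_(i < m) a i = 0 by rewrite a1 => /eqP; rewrite oner_eq0.
    apply: big1 => i _; have := psumr_eq0P (fun i _ => w0 i) S0 (i := i) isT.
    by move/eqP; rewrite mulf_eq0 invr_eq0 (gt_eqF (Gp_gt0 i)) orbF => /eqP.
  exists (fun i => w i / S); split.
  + by move=> i; rewrite divr_ge0// ltW.
  + by rewrite -mulr_suml divff// gt_eqF.
  + under eq_bigr do rewrite mulrC -scalerA.
    rewrite -scaler_sumr; suff -> : \sum_(i < m) w i *: G i = 0 by rewrite scaler0.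
    by rewrite -[RHS]aG; apply: eq_bigr => i _; rewrite /normalized scalerA.
Qed.
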